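(* Let $g_1$ and $g_2$ be conformally equivalent Riemannian metrics on a smooth manifold $M$ of dimension $m\ge 3$, i.e. $g_1=\alpha g_2$ for a smooth positive function $\alpha$ on $M$. Then $(M,g_1)$ is conformally Osserman if and only if $(M,g_2)$ is conformally Osserman.
   Context: Let $(M,g)$ be a smooth Riemannian manifold of dimension $m\ge 3$ with Levi-Civita connection $\nabla$. The curvature operator is $R(x,y)=\nabla_x\nabla_y-\nabla_y\nabla_x-\nabla_{[x,y]}$ and $R(x,y,z,w)=g(R(x,y)z,w)$. Relative to a local orthonormal frame $\{e_i\}$, the Ricci tensor is $\rho_{ij}=\sum_k R_{ikkj}$, the scalar curvature is $\tau=\sum_i\rho_{ii}$, and the Ricci operator is $\rho(e_i)=\sum_j\rho_{ij}e_j$. Set $$R_0(x,y)z=g(y,z)x-g(x,z)y,\qquad L(x,y)z=g(\rho y,z)x-g(\rho x,z)y+g(y,z)\rho x-g(x,z)\rho y.$$ The Weyl conformal curvature operator $W$ is defined by $$R(x,y)=W(x,y)-\frac{1}{(m-1)(m-2)}\,\tau R_0(x,y)+\frac{1}{m-2}L(x,y).$$ The conformal Jacobi operator is the self-adjoint map $J_W(x)y=W(y,x)x$. $(M,g)$ is conformally Osserman if for each $P\in M$ the eigenvalues (with multiplicity) of $J_W(x)$ are constant for $x$ in the unit sphere $S_P(M,g)=\{x\in T_PM: g(x,x)=1\}$; the eigenvalues may vary from point to point. *)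

(* Defs.v *)
From HB Require Import structures.
From mathcomp Require Import all_boot all_order all_algebra.
From mathcomp Require Import all_classical all_reals all_analysis.
From mathcomp Require Import ring.

Set Implicit Arguments.
Unset Strict Implicit.
Unset Printing Implicit Defensive.

Import Order.TTheory GRing.Theory Num.Theory.
Import numFieldNormedType.Exports.

Local Open Scope classical_set_scope.
Local Open Scope ring_scope.

(* [f] is of class C^k on the open set [U].  In finite dimension the
   differential of [f] is C^k iff each ['D_v f] is. *)
Fixpoint Ck_on (R : realType) (n : nat) (W : normedModType R) (k : nat)
    (U : set 'rV[R]_n) (f : 'rV[R]_n -> W) : Prop :=
  match k with
  | 0 => forall u, U u -> {for u, continuous f}
  | k'.+1 => (forall u, U u -> differentiable f u) /\
             (forall v : 'rV[R]_n, Ck_on k' U ('D_v f))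
  end.

Definition smooth_on (R : realType) (n : nat) (W : normedModType R)
    (U : set 'rV[R]_n) (f : 'rV[R]_n -> W) : Prop :=
  forall k, Ck_on k U f.

(* A homeomorphism from the open set [cdom] of [T] onto an open subset of R^m;
   [cmap] and [cinv] are total functions, meaningful only on [cdom] and on its
   image respectively. *)
Record chart (R : realType) (m : nat) (T : topologicalType) := Chart {
  cdom : set T;
  cmap : T -> 'rV[R]_m;
  cinv : 'rV[R]_m -> T;
  cdom_open : open cdom;
  cimg_open : open (cmap @` cdom);
  cmapK : forall p, cdom p -> cinv (cmap p) = p;
  cmap_continuous : forall p, cdom p -> {for p, continuous cmap};
  cinv_continuous : forall u, (cmap @` cdom) u -> {for u, continuous cinv}
}.

Definition transition (R : realType) (m : nat) (T : topologicalType)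
    (c c' : chart R m T) : 'rV[R]_m -> 'rV[R]_m :=
  cmap c' \o cinv c.

(* The atlas need not be maximal. *)
Record smooth_manifold (R : realType) (m : nat) := SmoothManifold {
  carrier :> topologicalType;
  manifold_hausdorff : hausdorff_space carrier;
  manifold_second_countable : @second_countable carrier;
  atlas : set (chart R m carrier);
  atlas_cover : forall p : carrier, exists2 c, atlas c & cdom c p;
  atlas_smooth : forall c c', atlas c -> atlas c' ->
    smooth_on (cmap c @` (cdom c `&` cdom c')) (transition c c')
}.

Definition smooth_function (R : realType) (m : nat) (M : smooth_manifold R m)
    (f : M -> R) : Prop :=
  forall c, atlas c -> smooth_on (cmap c @` cdom c) (f \o cinv c : _ -> R^o).

(* Tangent vectors are row vectors of components in the coordinate frame of a
   chart; [G u] is the Gram matrix of that frame at the point of coordinates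
   [u]. *)
Definition inner (R : realType) (m : nat) (G : 'rV[R]_m -> 'M[R]_m)
    (u x y : 'rV[R]_m) : R :=
  (x *m G u *m y^T) 0 0.

(* A smooth positive definite symmetric covariant 2-tensor, given by its
   components in each chart of the atlas. *)
Record riemannian_metric (R : realType) (m : nat) (M : smooth_manifold R m) :=
  RiemannianMetric {
  gram : chart R m M -> 'rV[R]_m -> 'M[R]_m;
  gram_smooth : forall c, atlas c -> smooth_on (cmap c @` cdom c) (gram c);
  gram_sym : forall c p, atlas c -> cdom c p ->
    (gram c (cmap c p))^T = gram c (cmap c p);
  gram_posdef : forall c p, atlas c -> cdom c p ->
    forall x : 'rV[R]_m, x != 0 -> 0 < inner (gram c) (cmap c p) x x;
  gram_change : forall c c' p, atlas c -> atlas c' -> cdom c p -> cdom c' p ->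
    gram c (cmap c p) =
      'J (transition c c') (cmap c p) *m gram c' (cmap c' p)
        *m ('J (transition c c') (cmap c p))^T
}.

Section Curvature.
Variables (R : realType) (m : nat) (G : 'rV[R]_m -> 'M[R]_m).
Implicit Types (u x y z : 'rV[R]_m) (X Y Z : 'rV[R]_m -> 'rV[R]_m).

(* The bilinear extension of the Christoffel symbols: the vector whose inner
   product with the l-th coordinate field is
   (x g(y, e_l) + y g(x, e_l) - e_l g(x, y)) / 2. *)
Definition christoffel u x y : 'rV[R]_m :=
  (\row_l (2^-1 *
     ('D_x (fun w => inner G w y (delta_mx 0 l) : R^o) u
      + 'D_y (fun w => inner G w x (delta_mx 0 l) : R^o) u
      - 'D_(delta_mx 0 l) (fun w => inner G w x y : R^o) u)))
  *m invmx (G u).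

(* Vector fields are functions of the coordinates; [nabla X Y] is the
   Levi-Civita derivative of Y along X (see [nabla_torsion_free] and
   [nabla_metric]). *)
Definition nabla X Y : 'rV[R]_m -> 'rV[R]_m :=
  fun u => 'D_(X u) Y u + christoffel u (X u) (Y u).

Definition lie_bracket X Y : 'rV[R]_m -> 'rV[R]_m :=
  fun u => 'D_(X u) Y u - 'D_(Y u) X u.

Definition curvature_field X Y Z : 'rV[R]_m -> 'rV[R]_m :=
  fun u => nabla X (nabla Y Z) u - nabla Y (nabla X Z) u
           - nabla (lie_bracket X Y) Z u.

(* By tensoriality the value at a point may be computed by extending the
   tangent vectors to fields with constant components. *)
Definition curvature u x y z : 'rV[R]_m :=
  curvature_field (cst x) (cst y) (cst z) u.

Definition curvature4 u x y z w : R := inner G u (curvature u x y z) w.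

(* The rows of [E] form an orthonormal basis of the tangent space at [u]. *)
Definition orthonormal_frame u (E : 'M[R]_m) : Prop :=
  forall i j, inner G u (row i E) (row j E) = (i == j)%:R.

Section Frame.
Variables (u : 'rV[R]_m) (E : 'M[R]_m).

Definition ricci x y : R :=
  \sum_(k < m) curvature4 u x (row k E) (row k E) y.

Definition scalar_curvature : R := \sum_(i < m) ricci (row i E) (row i E).

Definition ricci_op x : 'rV[R]_m :=
  \sum_(j < m) ricci x (row j E) *: row j E.

Definition R0 x y z : 'rV[R]_m := inner G u y z *: x - inner G u x z *: y.

Definition L x y z : 'rV[R]_m :=
  inner G u (ricci_op y) z *: x - inner G u (ricci_op x) z *: y
  + inner G u y z *: ricci_op x - inner G u x z *: ricci_op y.

Definition weyl x y z : 'rV[R]_m :=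
  curvature u x y z
  + (((m%:R - 1) * (m%:R - 2))^-1 * scalar_curvature) *: R0 x y z
  - (m%:R - 2)^-1 *: L x y z.

(* The matrix, acting on row vectors, of y |-> W(y, x) x. *)
Definition conformal_jacobi x : 'M[R]_m := lin1_mx (fun y => weyl y x x).

End Frame.

Lemma innerE u x y : inner G u x y = \sum_i \sum_j x 0 i * G u i j * y 0 j.
Proof.
rewrite /inner mxE exchange_big /=; apply: eq_bigr => j _.
by rewrite !mxE big_distrl.
Qed.

Lemma is_derive_coord n p (F : 'rV[R]_m -> 'M[R]_(n, p)) u v i j :
  derivable F u v -> is_derive u v (fun w => F w i j : R^o) ('D_v F u i j).
Proof.
move=> dF; have dFij := (derivable_mxP F u v).1 dF i j.
by rewrite (derive_mx dF) mxE; exact: derivableP dFij.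
Qed.

Lemma is_derive_inner Y Z u v :
  derivable G u v -> derivable Y u v -> derivable Z u v ->
  is_derive u v (fun w => inner G w (Y w) (Z w) : R^o)
    (('D_v Y u *m G u *m (Z u)^T) 0 0 + (Y u *m 'D_v G u *m (Z u)^T) 0 0
     + (Y u *m G u *m ('D_v Z u)^T) 0 0).
Proof.
move=> dG dY dZ.
have -> : (fun w => inner G w (Y w) (Z w) : R^o) =
    \sum_i \sum_j ((fun w => Y w 0 i) * (fun w => G w i j)
                   * (fun w => Z w 0 j) : _ -> R^o).
  by apply/funext => w; rewrite innerE fct_sumE; apply: eq_bigr => i _;
     rewrite fct_sumE.
have hY i := is_derive_coord 0 i dY.
have hZ i := is_derive_coord 0 i dZ.
have hG i j := is_derive_coord i j dG.
have expand (a b : 'rV[R]_m) (A : 'M[R]_m) :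
    (a *m A *m b^T) 0 0 = \sum_i \sum_j a 0 i * A i j * b 0 j.
  rewrite mxE exchange_big /=; apply: eq_bigr => j _.
  by rewrite !mxE big_distrl.
rewrite !expand -!big_split /=; apply: is_derive_sum => i.
rewrite -!big_split /=; apply: is_derive_sum => j.
apply: is_derive_eq; rewrite /GRing.scale /= !fctE; ring.
Qed.

Lemma derive_inner_cst u v x y : derivable G u v ->
  'D_v (fun w => inner G w x y : R^o) u = (x *m 'D_v G u *m y^T) 0 0.
Proof.
move=> dG.
have := @is_derive_inner (cst x) (cst y) u v dG (derivable_cst _ _ _)
  (derivable_cst _ _ _).
rewrite !derive_cst trmx0 mulmx0 !mul0mx !mxE add0r addr0.
by move=> H; rewrite derive_val.
Qed.

Lemma inner_koszul u x y z :
  (G u)^T = G u -> G u \in unitmx -> differentiable G u ->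
  inner G u (christoffel u x y) z =
  2^-1 * ((y *m 'D_x G u *m z^T) 0 0 + (x *m 'D_y G u *m z^T) 0 0
          - (x *m 'D_z G u *m y^T) 0 0).
Proof.
move=> sG uG dG.
have dGv v : derivable G u v by exact: diff_derivable.
rewrite /inner /christoffel mulmxKV // mxE.
have lin (f : 'rV[R]_m -> R) : linear (f : _ -> R^o) ->
    f z = \sum_l f (delta_mx 0 l) * z 0 l.
  move=> lf.
  pose fL : {linear 'rV[R]_m -> R^o} := HB.pack f (GRing.isLinear.Build _ _ _ _ f lf).
  rewrite -[f z]/(fL z) [in LHS](row_sum_delta z) linear_sum.
  by apply: eq_bigr => l _; rewrite linearZ /= mulrC.
pose f w : R := 2^-1 * ((y *m 'D_x G u *m w^T) 0 0
   + (x *m 'D_y G u *m w^T) 0 0 - (x *m 'D_w G u *m y^T) 0 0).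
rewrite -/(f z) (lin f).
  by apply: eq_bigr => l _; rewrite !mxE !derive_inner_cst.
move=> k a b; rewrite /f !deriveE // !linearP /= !mulmxDl.
rewrite -!scalemxAl !mxE /GRing.scale /=; ring.
Qed.

Lemma trmx_derive u v : (\forall w \near u, (G w)^T = G w) ->
  derivable G u v -> ('D_v G u)^T = 'D_v G u.
Proof.
move=> sG dG; rewrite derive_mx //; apply/matrixP => i j; rewrite !mxE.
apply: near_eq_derive; apply: filterS sG => w sGw.
by rewrite -[in LHS]sGw mxE.
Qed.

Lemma trmx_form (a b : 'rV[R]_m) (A : 'M[R]_m) :
  (a *m A *m b^T) 0 0 = (b *m A^T *m a^T) 0 0.
Proof.
rewrite [LHS](_ : _ = ((a *m A *m b^T)^T) 0 0); last by rewrite [RHS]mxE.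
by rewrite !trmx_mul trmxK mulmxA.
Qed.

Lemma nabla_torsion_free X Y u : (\forall w \near u, (G w)^T = G w) ->
  nabla X Y u - nabla Y X u = lie_bracket X Y u.
Proof.
move=> sG; suff cC : christoffel u (X u) (Y u) = christoffel u (Y u) (X u).
  by rewrite /nabla /lie_bracket cC opprD addrACA subrr addr0.
rewrite /christoffel; apply: (congr1 (mulmx^~ _)).
apply/rowP => l; rewrite [LHS]mxE [RHS]mxE; apply: (congr1 ( *%R 2^-1)).
rewrite [X in X - _]addrC; apply: (congr1 (+%R _)); apply: (congr1 -%R).
apply: near_eq_derive; apply: filterS sG => w sGw.
by rewrite /inner trmx_form sGw.
Qed.

Lemma nabla_metric X Y Z u :
  (\forall w \near u, (G w)^T = G w) -> G u \in unitmx ->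
  differentiable G u -> differentiable Y u -> differentiable Z u ->
  'D_(X u) (fun w => inner G w (Y w) (Z w) : R^o) u =
  inner G u (nabla X Y u) (Z u) + inner G u (Y u) (nabla X Z u).
Proof.
move=> sG uG dG dY dZ.
have sGu : (G u)^T = G u by exact: nbhs_singleton sG.
have innerC x y : inner G u x y = inner G u y x by rewrite /inner trmx_form sGu.
have innerDl x y z : inner G u (x + y) z = inner G u x z + inner G u y z.
  by rewrite /inner !mulmxDl mxE.
have [B BE] : exists B : 'rV[R]_m -> 'rV[R]_m -> 'rV[R]_m -> R,
    forall v x y, (x *m 'D_v G u *m y^T) 0 0 = B v x y.
  by exists (fun v x y => (x *m 'D_v G u *m y^T) 0 0).
have BC v x y : B v x y = B v y x.
  rewrite -!BE trmx_form trmx_derive //; exact: diff_derivable.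
have koszul x y z : inner G u (christoffel u x y) z =
    2^-1 * (B x y z + B y x z - B z x y) by rewrite -!BE; exact: inner_koszul.
have [_ ->] := is_derive_inner (diff_derivable dG : derivable G u (X u))
  (diff_derivable dY) (diff_derivable dZ).
rewrite (BE (X u) (Y u) (Z u)) /nabla (innerC (Y u)) !innerDl !koszul (innerC _ (Y u)).
rewrite (BC (X u) (Z u)) /inner; by field.
Qed.

End Curvature.

(* For a self-adjoint map the multiplicity of an eigenvalue is the dimension of
   its eigenspace. *)
Definition same_eigenvalues (R : realType) (m : nat) (A B : 'M[R]_m) : Prop :=
  forall a : R, \rank (eigenspace A a) = \rank (eigenspace B a).

(* Neither the chart around [p] nor the orthonormal frame used to contract the
   curvature matters. *)
Definition conformally_osserman (R : realType) (m : nat)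
    (M : smooth_manifold R m) (g : riemannian_metric M) : Prop :=
  forall (p : M) (c : chart R m M), atlas c -> cdom c p ->
  forall E : 'M[R]_m, orthonormal_frame (gram g c) (cmap c p) E ->
  forall x y : 'rV[R]_m,
    inner (gram g c) (cmap c p) x x = 1 ->
    inner (gram g c) (cmap c p) y y = 1 ->
    same_eigenvalues (conformal_jacobi (gram g c) (cmap c p) E x)
                     (conformal_jacobi (gram g c) (cmap c p) E y).

Definition conformally_equivalent (R : realType) (m : nat)
    (M : smooth_manifold R m) (g1 g2 : riemannian_metric M) : Prop :=
  exists alpha : M -> R,
    [/\ smooth_function alpha,
        forall p, 0 < alpha p &
        forall c p, atlas c -> cdom c p ->
          gram g1 c (cmap c p) = alpha p *: gram g2 c (cmap c p)].

(* Main.v *)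
(* Write [g1 = f g2] and let [A] be the [g2]-gradient of [ln f / 2], with
   [a = g2 (A, -)].  The Christoffel symbols change by
   [a(x) y + a(y) x - g2(x,y) A], so, the second derivatives of [f] being
   symmetric, the curvature changes by the Kulkarni-Nomizu type term
   [- (h(y,z) x - h(x,z) y + g2(y,z) H x - g2(x,z) H y)] where
   [H x = nabla_x A - a(x) A + |A|^2 x / 2] is self-adjoint and
   [h(x,y) = g2(H x,y)].  Contracting, the Ricci and scalar curvatures change in
   such a way that the (1,3) Weyl tensors coincide.  A vector [x] is
   [g2]-unit iff [f^(-1/2) x] is [g1]-unit, hence the conformal Jacobi operators
   of [g1] on its unit sphere are those of [g2] divided by [f]. *)
Require Import Defs.
From HB Require Import structures.
From mathcomp Require Import all_boot all_order all_algebra all_fingroup.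
From mathcomp Require Import all_classical all_reals all_analysis.
From mathcomp Require Import ring.

Set Implicit Arguments.
Unset Strict Implicit.
Unset Printing Implicit Defensive.

Import Order.TTheory GRing.Theory Num.Theory.
Import numFieldNormedType.Exports.

Local Open Scope classical_set_scope.
Local Open Scope ring_scope.

(** * Calculus in normed spaces *)

(** Write [g] as [f + (g - f)]. The difference vanishes near [a], so the zero map serves as its
    differential. *)
Lemma near_eq_differentiable (R : realType) (V W : normedModType R)
    (f g : V -> W) (a : V) :
  (\forall x \near a, f x = g x) -> differentiable f a -> differentiable g a.
Proof.
move=> fg df; have -> : g = f + (g - f) by rewrite addrC subrK.
apply: differentiableD => //.
have o0 : (g - f) \o shift a = cst ((g - f) a) + \0 +o_ 0 id.
  apply/eqaddoP => _/posnumP[e].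
  have : \forall h \near 0, f (h + a) = g (h + a).
    by move: fg; rewrite (near_shift 0) subr0.
  apply: filterS => h /= fgh; rewrite !fctE /=.
  by rewrite fgh (nbhs_singleton fg) !subrr addr0 subrr normr0 mulr_ge0.
have c0 : continuous (\0 : V -> W) by exact: cst_continuous.
have d0 := diff_unique c0 o0.
by apply/diff_locallyP; rewrite d0.
Qed.

(** * Differentiability of matrix-valued functions *)

Section DifferentiableMatrix.
Variables (R : realType) (V : normedModType R).

Lemma differentiable_mx p q (F : V -> 'M[R]_(p, q)) u :
  (forall i j, differentiable (fun w => F w i j : R^o) u) ->
  differentiable F u.
Proof.
move=> dF.
have -> : F = \sum_(i < p) \sum_(j < q) (fun w => F w i j *: delta_mx i j).
  apply/funext => w; rewrite fct_sumE [LHS]matrix_sum_delta.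
  by apply: eq_bigr => i _; rewrite fct_sumE.
do 2 apply: differentiable_sum => ?; exact: differentiableZl.
Qed.

Lemma differentiable_entry p q (F : V -> 'M[R]_(p, q)) u i j :
  differentiable F u -> differentiable (fun w => F w i j : R^o) u.
Proof.
move=> dF; exact: (differentiable_comp dF (differentiable_coord (F u) i j)).
Qed.

Lemma differentiable_mulmx p q r (F : V -> 'M[R]_(p, q)) (H : V -> 'M[R]_(q, r))
    u :
  differentiable F u -> differentiable H u ->
  differentiable (fun w => F w *m H w) u.
Proof.
move=> dF dH; apply: differentiable_mx => i j.
have -> : (fun w => (F w *m H w) i j : R^o) =
    \sum_k ((fun w => F w i k) * (fun w => H w k j) : _ -> R^o).
  by apply/funext => w; rewrite mxE fct_sumE.
apply: differentiable_sum => k.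
by apply: differentiableM; apply: differentiable_entry.
Qed.

Lemma differentiable_det n (F : V -> 'M[R]_n) u :
  (forall i j, differentiable (fun w => F w i j : R^o) u) ->
  differentiable (fun w => \det (F w) : R^o) u.
Proof.
move=> dF; rewrite /determinant.
have -> : (fun w => \sum_(s : 'S_n) (-1) ^+ s * \prod_i F w i (s i) : R^o) =
    \sum_(s : 'S_n) ((-1) ^+ s *: ((fun w => \prod_i F w i (s i)) : _ -> R^o)).
  by apply/funext => w; rewrite fct_sumE.
elim/big_ind: _ => [|a b|s _]; first exact: differentiable_cst.
  exact: differentiableD.
apply: differentiableZ.
have -> : (fun w => \prod_i F w i (s i) : R^o) =
    \prod_i ((fun w => F w i (s i)) : _ -> R^o).
  by apply/funext => w; rewrite fct_prodE.
elim/big_ind: _ => [|a b|i _] //.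
exact: differentiableM.
Qed.

(** Cramer's formula expresses the inverse by determinants. It agrees with [invmx] only where [F] is
    invertible, since [invmx] returns a singular matrix unchanged; hence the condition on a
    neighbourhood of [u]. *)
Lemma differentiable_invmx n (F : V -> 'M[R]_n) u :
  (\forall w \near u, F w \in unitmx) -> differentiable F u ->
  differentiable (fun w => invmx (F w)) u.
Proof.
move=> uF dF; apply: (@near_eq_differentiable _ _ _
  (fun w => (\det (F w))^-1 *: \adj (F w))).
  by apply: filterS uF => w uFw; rewrite /invmx uFw.
have dFij i j := differentiable_entry i j dF.
have u0 : \det (F u) != 0 by move: (nbhs_singleton uF); rewrite unitmxE unitfE.
apply: differentiable_mx => i j.
have -> : (fun w => ((\det (F w))^-1 *: \adj (F w)) i j : R^o) =
    (fun w => (\det (F w))^-1) * ((-1) ^+ (j + i) *: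
      (fun w => \det (row' j (col' i (F w))) : R^o)).
  by apply/funext => w; rewrite !mxE.
apply: differentiableM; first apply: differentiableV => //.
  exact: differentiable_det.
apply: differentiableZ; apply: differentiable_det => k l.
by under eq_fun do rewrite !mxE.
Qed.

End DifferentiableMatrix.

(** * Symmetry of second derivatives *)

Section Schwarz.
Variables (R : realType) (V : normedModType R) (f : V -> R^o).

Lemma is_derive_line (g : V -> R^o) (x b : V) (s : R) :
  differentiable g (s *: x + b) ->
  is_derive s 1 (fun t : R => g (t *: x + b) : R^o) ('D_x g (s *: x + b)).
Proof.
move=> dg; have dl : is_diff s (fun t : R => t *: x + b) ( *:%R^~ x).
  by apply: is_diff_eq; rewrite addr0.
have dgl : differentiable (g \o (fun t : R => t *: x + b)) s.
  by apply: differentiable_comp.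
apply: DeriveDef; first exact/derivable1_diffP.
rewrite deriveE //; have := @diff_comp _ _ _ _ (fun t : R => t *: x + b) g s.
move=> -> //.
by rewrite /= diff_val /= scale1r deriveE.
Qed.

(** Two uses of the mean value theorem: first along [x], for the difference [F] of [f] on two
    opposite sides of the parallelogram, then along [y], for ['D_x f]. The set [A] carries whatever
    must be known about the intermediate point. *)
Lemma second_difference (A : set V) (u x y : V) (h : R) : 0 < h ->
  (forall s t, 0 <= s <= h -> 0 <= t <= h -> A (s *: x + (t *: y + u))) ->
  (forall w, A w -> differentiable f w) ->
  (forall w, A w -> differentiable ('D_x f) w) ->
  exists2 w, A w &
    f (h *: x + (h *: y + u)) - f (h *: x + u) - f (h *: y + u) + f u
    = 'D_y ('D_x f) w * h * h.
Proof.
move=> h0 hA df dxf.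
have h1 : 0 <= h <= h by rewrite lexx ltW.
have h2 : 0 <= (0 : R) <= h by rewrite lexx ltW.
pose F (s : R) : R^o := f (s *: x + (h *: y + u)) - f (s *: x + u).
have dF s : 0 <= s <= h -> is_derive s 1 F
    ('D_x f (s *: x + (h *: y + u)) - 'D_x f (s *: x + u)).
  move=> s01; apply: is_deriveB; apply: is_derive_line; apply: df.
    exact: hA.
  by have := hA s 0 s01 h2; rewrite scale0r add0r.
have inW (s : R) : s \in `]0, h[%R -> 0 <= s <= h.
  by rewrite in_itv /= => /andP[/ltW -> /ltW ->].
have cW (g dg : R -> R^o) : (forall s, 0 <= s <= h -> is_derive s 1 g (dg s)) ->
    {within `[0, h], continuous g}.
  move=> dg'; apply: continuous_in_subspaceT => s.
  rewrite inE /= in_itv /= => s01.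
  apply: differentiable_continuous; apply/derivable1_diffP.
  by have [] := dg' s s01.
have [s s01 Fs] := MVT h0 (fun s sh => dF s (inW s sh)) (cW _ _ dF).
pose K (t : R) : R^o := 'D_x f (t *: y + (s *: x + u)).
have AK t : 0 <= t <= h -> A (t *: y + (s *: x + u)).
  by move=> t01; rewrite addrCA; apply: hA => //; exact: inW.
have dK t : 0 <= t <= h ->
    is_derive t 1 K ('D_y ('D_x f) (t *: y + (s *: x + u))).
  by move=> t01; apply: is_derive_line; apply: dxf; exact: AK.
have [t t01 Kt] := MVT h0 (fun t th => dK t (inW t th)) (cW _ _ dK).
exists (t *: y + (s *: x + u)); first exact/AK/inW.
move: Fs Kt; rewrite /F /K !subr0 !scale0r !add0r [h *: y + (s *: x + u)]addrCA.
move=> Fs Kt; rewrite -Kt; apply: etrans Fs; ring.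
Qed.

(** The second difference over a parallelogram does not depend on the order of [x] and [y], so the
    two mixed derivatives take a common value at two points close to [u]. Continuity at [u] then
    bounds their difference at [u] by any [e]. *)
Lemma derive_comm (u x y : V) :
  (\forall w \near u, differentiable f w) ->
  (\forall w \near u, differentiable ('D_x f) w) ->
  (\forall w \near u, differentiable ('D_y f) w) ->
  {for u, continuous ('D_y ('D_x f))} -> {for u, continuous ('D_x ('D_y f))} ->
  'D_y ('D_x f) u = 'D_x ('D_y f) u.
Proof.
move=> df dxf dyf cyx cxy; apply/eqP; rewrite -subr_eq0 -normr_le0.
apply/ler_addgt0Pl => e e0; rewrite addr0.
have e2 : 0 < e / 2 by rewrite divr_gt0.
pose A := [set w | [/\ differentiable f w, differentiable ('D_x f) w,
  differentiable ('D_y f) w,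
  `|'D_y ('D_x f) u - 'D_y ('D_x f) w| <= e / 2 &
  `|'D_x ('D_y f) u - 'D_x ('D_y f) w| <= e / 2]].
have nA : nbhs u A.
  move/cvgrPdist_le: cyx => /(_ _ e2) cyx.
  move/cvgrPdist_le: cxy => /(_ _ e2) cxy.
  apply: filterS (filterI df (filterI dxf (filterI dyf (filterI cyx cxy)))).
  by move=> w [a [b [c [d e']]]]; exact: And5 a b c d e'.
have /nbhs_ballP[d /= d0 dA] := nA.
(* With this [h] the parallelogram of sides [h *: x] and [h *: y] at [u] lies within distance
   [d / 2] of [u]. The summand 1 keeps the denominator positive when [x] and [y] vanish. *)
pose h := d / 2 / (`|x| + `|y| + 1).
have N0 : 0 < `|x| + `|y| + 1 by rewrite ltr_wpDl ?addr_ge0.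
have h0 : 0 < h by rewrite !divr_gt0.
have hA s t : 0 <= s <= h -> 0 <= t <= h -> A (s *: x + (t *: y + u)).
  move=> /andP[s0 sh] /andP[t0 th]; apply: dA; rewrite -ball_normE /= addrA.
  rewrite opprD addrCA subrr addr0 normrN.
  apply: le_lt_trans (ler_normD _ _) _; rewrite !normrZ !ger0_norm //.
  apply: (@le_lt_trans _ _ (h * (`|x| + `|y| + 1))).
    rewrite !mulrDr mulr1 -addrA lerD ?ler_wpM2r //.
    by apply: ler_wpDr; [exact: ltW | rewrite ler_wpM2r].
  by rewrite /h divfK ?gt_eqF // ltr_pdivrMr // ltr_pMr // ltr1n.
have hA' s t : 0 <= s <= h -> 0 <= t <= h -> A (s *: y + (t *: x + u)).
  by move=> s0 t0; rewrite addrCA; exact: hA.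
have Af w : A w -> differentiable f w by case.
have Ax w : A w -> differentiable ('D_x f) w by case.
have Ay w : A w -> differentiable ('D_y f) w by case.
have [w Aw E1] := second_difference h0 hA Af Ax.
have [w' Aw' E2] := second_difference h0 hA' Af Ay.
(* Both sides times [h * h] are the same second difference. *)
have E : 'D_y ('D_x f) w = 'D_x ('D_y f) w'.
  move: E1 E2; rewrite [h *: y + (h *: x + u)]addrCA.
  have cancel (a b c c' f0 e' : R) : a - c - c' + f0 = b * h * h ->
      a - c' - c + f0 = e' * h * h -> b = e'.
    rewrite [a - c - c']addrAC => -> E3.
    have hn0 : h != 0 by rewrite gt_eqF.
    by do 2 apply: (mulIf hn0).
  exact: cancel.
case: Aw => _ _ _ Aw _; case: Aw' => _ _ _ _ Aw'.
have triangle (a b c : R) : `|a - b| <= e / 2 -> `|c - b| <= e / 2 ->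
    `|a - c| <= e.
  rewrite -[`|c - b|]distrC => ab bc; rewrite -(subrKA b) (splitr e).
  exact: le_trans (ler_normD _ _) (lerD ab bc).
by move: Aw; rewrite E => Aw; exact: triangle Aw Aw'.
Qed.

End Schwarz.

(** * Levi-Civita connection and curvature in a chart *)

(* The locked copies below keep unification from unfolding inner products and
   derivatives when their arguments differ. *)
HB.lock Definition dot (R : realType) (m : nat) (G : 'rV[R]_m -> 'M[R]_m)
  (u x y : 'rV[R]_m) : R := inner G u x y.

HB.lock Definition dinner (R : realType) (m : nat) (G : 'rV[R]_m -> 'M[R]_m)
  (u v x y : 'rV[R]_m) : R := (x *m 'D_v G u *m y^T) 0 0.

HB.lock Definition Gamma (R : realType) (m : nat) (G : 'rV[R]_m -> 'M[R]_m)
  (u x y : 'rV[R]_m) : 'rV[R]_m := christoffel G u x y.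

Lemma dotE (R : realType) m (G : 'rV[R]_m -> 'M[R]_m) : inner G = dot G.
Proof. by rewrite dot.unlock. Qed.

Lemma GammaE (R : realType) m (G : 'rV[R]_m -> 'M[R]_m) :
  christoffel G = Gamma G.
Proof. by rewrite Gamma.unlock. Qed.

(** * Bilinear algebra of the metric at a point *)

Section Dot.
Variables (R : realType) (m : nat) (G : 'rV[R]_m -> 'M[R]_m) (u : 'rV[R]_m).
Implicit Types x y z : 'rV[R]_m.

Lemma dotDl x y z : dot G u (x + y) z = dot G u x z + dot G u y z.
Proof. by rewrite dot.unlock /inner !mulmxDl mxE. Qed.

Lemma dotDr x y z : dot G u z (x + y) = dot G u z x + dot G u z y.
Proof. by rewrite dot.unlock /inner linearD mulmxDr mxE. Qed.

Lemma dotZl a x z : dot G u (a *: x) z = a * dot G u x z.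
Proof. by rewrite dot.unlock /inner -!scalemxAl mxE. Qed.

Lemma dotZr a x z : dot G u z (a *: x) = a * dot G u z x.
Proof. by rewrite dot.unlock /inner linearZ -scalemxAr mxE. Qed.

Lemma dotNl x z : dot G u (- x) z = - dot G u x z.
Proof. by rewrite -scaleN1r dotZl mulN1r. Qed.

Lemma dotNr x z : dot G u z (- x) = - dot G u z x.
Proof. by rewrite -scaleN1r dotZr mulN1r. Qed.

Definition dot_lin := (dotDl, dotDr, dotZl, dotZr, dotNl, dotNr).

Lemma dotC x y : (G u)^T = G u -> dot G u x y = dot G u y x.
Proof. by move=> sG; rewrite dot.unlock /inner trmx_form sG. Qed.

Lemma dot_suml I (r : seq I) (P : pred I) (F : I -> 'rV[R]_m) z :
  dot G u (\sum_(i <- r | P i) F i) z = \sum_(i <- r | P i) dot G u (F i) z.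
Proof. by rewrite dot.unlock /inner !mulmx_suml summxE. Qed.

(** Nondegeneracy of the metric: identities between Christoffel vectors are checked by pairing them
    with an arbitrary [z] and using the Koszul formula. *)
Lemma dot_inj x y : G u \in unitmx ->
  (forall z, dot G u x z = dot G u y z) -> x = y.
Proof.
move=> uG xy; apply: (can_inj (mulmxK uG)); apply/rowP => j.
have := xy (delta_mx 0 j); rewrite dot.unlock /inner trmx_delta -!colE.
by rewrite [LHS]mxE [RHS]mxE.
Qed.

Lemma dinnerPr v x y y' a :
  dinner G u v x (a *: y + y') = a * dinner G u v x y + dinner G u v x y'.
Proof. by rewrite dinner.unlock linearP /= mulmxDr -scalemxAr !mxE. Qed.

Lemma dinnerPl v x y y' a :
  dinner G u v (a *: y + y') x = a * dinner G u v y x + dinner G u v y' x.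
Proof. by rewrite dinner.unlock !mulmxDl -!scalemxAl !mxE. Qed.

End Dot.

(** What the local computations use of a metric in coordinates: symmetry, nondegeneracy, and enough
    regularity to differentiate the Christoffel symbols once. *)
Record C2_metric (R : realType) (m : nat) (U : set 'rV[R]_m)
    (G : 'rV[R]_m -> 'M[R]_m) : Prop := C2Metric {
  C2_open : open U;
  C2_sym : forall u, U u -> (G u)^T = G u;
  C2_unit : forall u, U u -> G u \in unitmx;
  C2_diff : forall u, U u -> differentiable G u;
  C2_diff2 : forall u v, U u -> differentiable ('D_v G) u
}.

(** * Christoffel symbols and curvature in coordinates *)

Section Metric.
Variables (R : realType) (m : nat) (U : set 'rV[R]_m) (G : 'rV[R]_m -> 'M[R]_m).
Variable (mG : C2_metric U G).
Implicit Types (u v x y z : 'rV[R]_m).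
Local Notation Gamma := (Gamma G).
Local Notation dot := (dot G).
Local Notation dinner := (dinner G).

Lemma near_C2 u : U u -> \forall w \near u, U w.
Proof. by move=> Uu; apply: open_nbhs_nbhs; split => //; exact: C2_open mG. Qed.

Lemma dinnerC u v x y : U u -> dinner u v x y = dinner u v y x.
Proof.
move=> Uu; rewrite dinner.unlock trmx_form trmx_derive //.
  by apply: filterS (near_C2 Uu) => w; exact: C2_sym.
exact/diff_derivable/(C2_diff mG).
Qed.

Lemma derive_dotE u v x y : U u ->
  'D_v (fun w => dot w x y : R^o) u = dinner u v x y.
Proof.
move=> Uu; rewrite dot.unlock dinner.unlock; apply: derive_inner_cst.
exact/diff_derivable/(C2_diff mG).
Qed.

Lemma differentiable_dot u y z : U u ->
  differentiable (fun w => dot w y z : R^o) u.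
Proof.
move=> Uu; rewrite dot.unlock; apply: differentiable_entry.
apply: differentiable_mulmx; last exact: differentiable_cst.
apply: differentiable_mulmx; first exact: differentiable_cst.
exact: C2_diff mG _ Uu.
Qed.

Lemma koszul u x y z : U u -> dot u (Gamma u x y) z =
  2^-1 * (dinner u x y z + dinner u y x z - dinner u z x y).
Proof.
move=> Uu; rewrite dot.unlock dinner.unlock Gamma.unlock; apply: inner_koszul;
  [exact: C2_sym mG _ Uu | exact: C2_unit mG _ Uu | exact: C2_diff mG _ Uu].
Qed.

Lemma dinnerP u v v' x y a : U u ->
  dinner u (a *: v + v') x y = a * dinner u v x y + dinner u v' x y.
Proof.
move=> Uu; rewrite dinner.unlock !deriveE; try exact: C2_diff mG _ Uu.
by rewrite linearP /= mulmxDr mulmxDl -scalemxAr -scalemxAl !mxE.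
Qed.

Lemma differentiable_dinner u v x y : U u ->
  differentiable (fun w => dinner w v x y : R^o) u.
Proof.
move=> Uu; rewrite dinner.unlock; apply: differentiable_entry.
apply: differentiable_mulmx.
  apply: differentiable_mulmx; last exact: C2_diff2 mG _ _ Uu.
  exact: differentiable_cst.
exact: differentiable_cst.
Qed.

Lemma GammaC u x y : U u -> Gamma u x y = Gamma u y x.
Proof.
move=> Uu; apply: dot_inj (C2_unit mG Uu) _ => z.
by rewrite !koszul // (dinnerC z x y) // [dinner u x y z + _]addrC.
Qed.

Lemma GammaP u x y y' a : U u ->
  Gamma u x (a *: y + y') = a *: Gamma u x y + Gamma u x y'.
Proof.
move=> Uu; apply: dot_inj (C2_unit mG Uu) _ => z.
rewrite dotDl dotZl !koszul // dinnerP // dinnerPl dinnerPr; ring.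
Qed.

Lemma Gamma0 u x : U u -> Gamma u x 0 = 0.
Proof.
move=> Uu; have := GammaP x 0 0 (-1) Uu.
by rewrite scaler0 addr0 scaleN1r addNr.
Qed.

Lemma GammaD u x y y' : U u -> Gamma u x (y + y') = Gamma u x y + Gamma u x y'.
Proof. by move=> Uu; rewrite -[y in LHS]scale1r GammaP // scale1r. Qed.

Lemma GammaZ u x y a : U u -> Gamma u x (a *: y) = a *: Gamma u x y.
Proof. by move=> Uu; rewrite -[a *: y]addr0 GammaP // Gamma0 // addr0. Qed.

Lemma GammaZl u x y a : U u -> Gamma u (a *: x) y = a *: Gamma u x y.
Proof. by move=> Uu; rewrite GammaC // GammaZ // GammaC. Qed.

(** Metric compatibility for constant fields: in the sum of the two Koszul formulas the derivatives
    along [x] and [y] cancel. *)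
Lemma dinner_compat u v x y : U u ->
  dinner u v x y = dot u (Gamma u v x) y + dot u x (Gamma u v y).
Proof.
move=> Uu; rewrite [dot u x _]dotC; last exact: C2_sym mG _ Uu.
rewrite !koszul // (dinnerC v y x) // (dinnerC x v y) // (dinnerC y v x) //.
by field.
Qed.

Lemma derive_dot u x y z : U u -> 'D_x (fun w => dot w y z : R^o) u =
  dot u (Gamma u x y) z + dot u y (Gamma u x z).
Proof. by move=> Uu; rewrite derive_dotE // dinner_compat. Qed.

Lemma differentiable_invgram u : U u -> differentiable (fun w => invmx (G w)) u.
Proof.
move=> Uu; apply: differentiable_invmx; last exact: C2_diff mG _ Uu.
by apply: filterS (near_C2 Uu) => w; exact: C2_unit.
Qed.

(** Near [u] the Christoffel vector is the Koszul covector [c], built from first derivatives of the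
    metric, times the inverse Gram matrix; both factors are differentiable. *)
Lemma differentiable_Gamma u x y : U u -> differentiable (fun w => Gamma w x y) u.
Proof.
move=> Uu; pose c w l : R := 2^-1 * (dinner w x y (delta_mx 0 l)
  + dinner w y x (delta_mx 0 l) - dinner w (delta_mx 0 l) x y).
apply: (@near_eq_differentiable _ _ _ (fun w => (\row_l c w l) *m invmx (G w))).
  apply: filterS (near_C2 Uu) => w Uw; rewrite Gamma.unlock.
  have dG v : derivable G w v by exact/diff_derivable/(C2_diff mG).
  rewrite /christoffel; congr (_ *m _); apply/rowP => l.
  by rewrite [LHS]mxE [RHS]mxE !derive_inner_cst // /c dinner.unlock.
apply: differentiable_mulmx (differentiable_invgram Uu).
apply: differentiable_mx => i l; under eq_fun do rewrite mxE.
apply: (@differentiableZ _ _ R^o).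
apply: differentiableB; last exact: differentiable_dinner.
by apply: differentiableD; exact: differentiable_dinner.
Qed.

(** For constant fields the bracket vanishes and [nabla] of a constant field is a Christoffel
    vector, which leaves the classical coordinate formula. *)
Lemma curvatureE u x y z : U u -> curvature G u x y z =
  'D_x (fun w => Gamma w y z) u - 'D_y (fun w => Gamma w x z) u
  + Gamma u x (Gamma u y z) - Gamma u y (Gamma u x z).
Proof.
move=> Uu; rewrite /curvature /curvature_field.
have nE a : nabla G (cst a) (cst z) = fun w => Gamma w a z.
  by apply/funext => w; rewrite /nabla derive_cst add0r GammaE.
have -> : lie_bracket (cst x) (cst y) = cst 0.
  by apply/funext => w; rewrite /lie_bracket !derive_cst subrr.
rewrite !nE GammaC // Gamma0 // subr0 /nabla /= !GammaE.
by rewrite opprD addrACA addrA.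
Qed.

Lemma curvatureN u x y z : U u -> curvature G u x y z = - curvature G u y x z.
Proof.
move=> Uu; rewrite !curvatureE // !opprD !opprK.
by rewrite [- _ + _ in RHS]addrC -!addrA; congr (_ + (_ + _)); rewrite addrC.
Qed.

Lemma derive_GammaZm u x y z a : U u ->
  'D_x (fun w => Gamma w (a *: y) z) u = a *: 'D_x (fun w => Gamma w y z) u.
Proof.
move=> Uu; rewrite -deriveZ; last exact/diff_derivable/differentiable_Gamma.
by apply: near_eq_derive; apply: filterS (near_C2 Uu) => w; exact: GammaZl.
Qed.

Lemma derive_GammaZl u x y z a : U u ->
  'D_(a *: x) (fun w => Gamma w y z) u = a *: 'D_x (fun w => Gamma w y z) u.
Proof.
move=> Uu; rewrite !deriveE; try exact: differentiable_Gamma.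
by rewrite linearZ.
Qed.

Lemma derive_GammaZr u x y z a : U u ->
  'D_x (fun w => Gamma w y (a *: z)) u = a *: 'D_x (fun w => Gamma w y z) u.
Proof.
move=> Uu; rewrite -deriveZ; last exact/diff_derivable/differentiable_Gamma.
by apply: near_eq_derive; apply: filterS (near_C2 Uu) => w; exact: GammaZ.
Qed.

Lemma curvatureZl u x y z a : U u ->
  curvature G u (a *: x) y z = a *: curvature G u x y z.
Proof.
move=> Uu; rewrite !curvatureE // derive_GammaZl // derive_GammaZm //.
by rewrite !GammaZl // GammaZ // -!scalerBr -!scalerDr -!scalerBr.
Qed.

Lemma curvatureZm u x y z a : U u ->
  curvature G u x (a *: y) z = a *: curvature G u x y z.
Proof.
by move=> Uu; rewrite curvatureN // curvatureZl // -scalerN -curvatureN.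
Qed.

Lemma curvatureZr u x y z a : U u ->
  curvature G u x y (a *: z) = a *: curvature G u x y z.
Proof.
move=> Uu; rewrite !curvatureE // !derive_GammaZr // !GammaZ //.
by rewrite -!scalerBr -!scalerDr -!scalerBr.
Qed.

(** * Expansion in an orthonormal frame *)

Section Frame.
Variables (u : 'rV[R]_m) (E : 'M[R]_m).
Hypotheses (Uu : U u) (oE : orthonormal_frame G u E).

Lemma frame_sum v : \sum_k dot u v (row k E) *: row k E = v.
Proof.
have EGE : E *m (G u *m E^T) = 1%:M.
  apply/matrixP => i j; rewrite mulmxA [RHS]mxE -oE /inner -row_mul tr_row.
  by rewrite [LHS]mxE [RHS]mxE; apply: eq_bigr => k _; rewrite !mxE.
(* For square matrices a right inverse is a left inverse: orthonormality of the rows becomes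
   completeness of the frame. *)
have := congr1 (mulmx v) (mulmx1C EGE); rewrite mulmx1 mulmxA => vE.
rewrite -[RHS]vE mulmx_sum_row; apply: eq_bigr => k _; congr (_ *: _).
rewrite dot.unlock /inner mulmxA [LHS]mxE [RHS]mxE.
by apply: eq_bigr => l _; rewrite !mxE.
Qed.

Lemma frame_dot v w :
  \sum_k dot u v (row k E) * dot u w (row k E) = dot u v w.
Proof.
rewrite -[v in RHS]frame_sum dot_suml; apply: eq_bigr => k _.
by rewrite dotZl [dot u w _]dotC //; exact: C2_sym mG _ Uu.
Qed.

End Frame.

(** * Homogeneity of the Ricci, Weyl and conformal Jacobi operators *)

Section Scaling.
Variables (u : 'rV[R]_m) (E : 'M[R]_m).
Hypothesis Uu : U u.

Lemma ricciZl a x y : ricci G u E (a *: x) y = a * ricci G u E x y.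
Proof.
rewrite /ricci mulr_sumr; apply: eq_bigr => k _.
by rewrite /curvature4 curvatureZl // !dotE dotZl.
Qed.

Lemma ricciZr a x y : ricci G u E x (a *: y) = a * ricci G u E x y.
Proof.
rewrite /ricci mulr_sumr; apply: eq_bigr => k _.
by rewrite /curvature4 !dotE dotZr.
Qed.

Lemma ricci_opZ a x : ricci_op G u E (a *: x) = a *: ricci_op G u E x.
Proof.
rewrite /ricci_op scaler_sumr; apply: eq_bigr => k _.
by rewrite ricciZl scalerA.
Qed.

Lemma weylZ a x y :
  weyl G u E y (a *: x) (a *: x) = a ^+ 2 *: weyl G u E y x x.
Proof.
rewrite /weyl curvatureZm // curvatureZr // /R0 /L ricci_opZ.
move: (scalar_curvature _ _ _) (curvature _ _ _ _ _) => t r.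
move: (ricci_op G u E x) (ricci_op G u E y) => p q.
rewrite !dotE !dot_lin.
move: (dot u _ _) (dot u _ _) (dot u _ _) (dot u _ _) => b c d e.
apply/rowP => i.
rewrite !mxE.
ring.
Qed.

(** [lin1_mx] records the values at the basis vectors, so the quadratic dependence of the Weyl
    operator on [x] transfers entry by entry. *)
Lemma conformal_jacobiZ a x :
  conformal_jacobi G u E (a *: x) = a ^+ 2 *: conformal_jacobi G u E x.
Proof.
apply/matrixP => i j; rewrite [LHS]mxE weylZ [LHS]mxE [RHS]mxE.
by congr (_ * _); rewrite [RHS]mxE.
Qed.

End Scaling.

End Metric.

(** * Conformal change of the metric *)

Lemma differentiable_scalemx (R : realType) (V : normedModType R) p q
    (k : V -> R^o) (F : V -> 'M[R]_(p, q)) u :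
  differentiable k u -> differentiable F u ->
  differentiable (fun w => k w *: F w) u.
Proof.
move=> dk dF; apply: differentiable_mx => i j.
rewrite (_ : (fun w => _) = k * (fun w => F w i j : R^o)).
  by apply: differentiableM => //; exact: differentiable_entry.
by apply/funext => w; rewrite mxE.
Qed.

Lemma is_derive_scalemx (R : realType) m p q
    (k : 'rV[R]_m -> R^o) (F : 'rV[R]_m -> 'M[R]_(p, q)) u v :
  differentiable k u -> differentiable F u ->
  is_derive u v (fun w => k w *: F w) ('D_v k u *: F u + k u *: 'D_v F u).
Proof.
move=> dk dF; have dkF := diff_derivable (v := v) (differentiable_scalemx dk dF).
apply: DeriveDef => //; rewrite derive_mx //; apply/matrixP => i j; rewrite mxE.
rewrite (_ : (fun w => _) = k * (fun w => F w i j : R^o)); last first.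
  by apply/funext => w; rewrite mxE.
have dkv : derivable k u v by exact: diff_derivable.
have dFv := is_derive_coord i j (diff_derivable dF : derivable F u v).
rewrite (deriveM dkv (ex_derive (is_derive := dFv))) derive_val 3!mxE.
move: ('D_v k u) ('D_v F u i j) => a b.
by rewrite addrC /GRing.scale /= [_ * a]mulrC.
Qed.

(* [dlog] and [grad] are the differential and the gradient of [ln f / 2]. *)
HB.lock Definition dlog (R : realType) (m : nat) (f : 'rV[R]_m -> R^o)
  (u x : 'rV[R]_m) : R := 2^-1 * ('D_x f u / f u).

HB.lock Definition grad (R : realType) (m : nat) (G : 'rV[R]_m -> 'M[R]_m)
  (f : 'rV[R]_m -> R^o) (u : 'rV[R]_m) : 'rV[R]_m :=
  (\row_l dlog f u (delta_mx 0 l)) *m invmx (G u).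

Section Conformal.
Variables (R : realType) (m : nat) (U : set 'rV[R]_m).
Variables (G G' : 'rV[R]_m -> 'M[R]_m) (f : 'rV[R]_m -> R^o).
Hypotheses (mG : C2_metric U G) (mG' : C2_metric U G').
Hypotheses (GE : forall u, U u -> G' u = f u *: G u)
  (f0 : forall u, U u -> f u != 0)
  (df : forall u, U u -> differentiable f u)
  (df2 : forall u v, U u -> differentiable ('D_v f) u)
  (cf2 : forall u v w, U u -> {for u, continuous ('D_w ('D_v f))}).
Implicit Types (u v w x y z : 'rV[R]_m).

(** Multiplying by [G u] undoes the inverse in [grad], leaving the values of [dlog] on the
    coordinate vectors; linearity of the differential of [f] extends them to [z]. *)
Lemma dot_grad u z : U u -> dot G u (grad G f u) z = dlog f u z.
Proof.
move=> Uu; rewrite dot.unlock grad.unlock /inner mulmxKV;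
  last exact: C2_unit mG _ Uu.
rewrite mxE dlog.unlock deriveE; last exact: df.
rewrite [in RHS](row_sum_delta z) linear_sum mulr_suml mulr_sumr.
apply: eq_bigr => l _; rewrite !mxE deriveE; last exact: df.
rewrite linearZ /=; move: ('d f u _) => c; rewrite /GRing.scale /=; ring.
Qed.

Lemma dot_conf u x y : U u -> dot G' u x y = f u * dot G u x y.
Proof.
by move=> Uu; rewrite dot.unlock /inner GE // -scalemxAr -scalemxAl mxE.
Qed.

Lemma dinner_conf u v x y : U u ->
  dinner G' u v x y = 'D_v f u * dot G u x y + f u * dinner G u v x y.
Proof.
move=> Uu; have dg := diff_derivable (v := v) (differentiable_dot mG x y Uu).
rewrite -(derive_dotE mG') // -(derive_dotE mG) //.
rewrite (_ : 'D_v _ u = 'D_v (f * (fun w => dot G w x y : R^o)) u); last first.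
  by apply: near_eq_derive; apply: filterS (near_C2 mG Uu) => w; exact: dot_conf.
have dfv : derivable f u v by exact/diff_derivable/df.
rewrite (deriveM dfv dg).
by rewrite addrC; congr (_ + _); rewrite [LHS]mulrC.
Qed.

(** Pair with [z] under [G'] and apply Koszul: by the product rule the terms with derivatives of [G]
    rebuild [Gamma G], and those with derivatives of [f] give the correction after division by
    [f]. *)
Lemma Gamma_conf u x y : U u -> Gamma G' u x y =
  Gamma G u x y + dlog f u x *: y + dlog f u y *: x - dot G u x y *: grad G f u.
Proof.
move=> Uu; apply: dot_inj (C2_unit mG' Uu) _ => z.
rewrite (koszul mG') // !dinner_conf // dot_conf // !dot_lin dot_grad //.
rewrite (koszul mG) // dlog.unlock.
have := f0 Uu; move: (f u) ('D_x f u) ('D_y f u) ('D_z f u) => t a b c t0.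
by field.
Qed.

Lemma differentiable_dlog u x : U u -> differentiable ((dlog f)^~ x : _ -> R^o) u.
Proof.
move=> Uu; rewrite dlog.unlock; apply: (@differentiableZ _ _ R^o).
apply: (@differentiableM _ _ ('D_x f) (fun w => (f w)^-1)); first exact: df2.
by apply: differentiableV; [exact: df | exact: f0].
Qed.

(** The form [dlog] is closed. By the quotient rule its derivative is a second derivative of [f],
    symmetric by [derive_comm], and a visibly symmetric product of first derivatives. *)
Lemma derive_dlogC u x y : U u ->
  'D_x ((dlog f)^~ y : _ -> R^o) u = 'D_y ((dlog f)^~ x : _ -> R^o) u.
Proof.
move=> Uu.
have H a b : 'D_a ((dlog f)^~ b : _ -> R^o) u =
    2^-1 * ('D_a ('D_b f) u / f u - 'D_a f u * 'D_b f u / f u ^+ 2).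
  have d1 : derivable ('D_b f) u a by exact/diff_derivable/df2.
  have d2 : derivable f u a by exact/diff_derivable/df.
  have d3 : derivable (fun w => (f w)^-1 : R^o) u a.
    by apply: derivableV => //; exact: f0.
  rewrite dlog.unlock.
  rewrite (_ : (fun w => _) =
    2^-1 *: ('D_b f * (fun w => (f w)^-1) : _ -> R^o)) //.
  rewrite (deriveZ _ (derivableM d1 d3)) (deriveM d1 d3) (deriveV (f0 Uu) d2).
  have := f0 Uu; rewrite /GRing.scale /=.
  move: ('D_a ('D_b f) u) ('D_a f u) ('D_b f u) (f u) => p q r s s0.
  by field.
rewrite !H (@derive_comm _ _ f u x y).
- by move: ('D_x f u) ('D_y f u) => p q; rewrite (mulrC p).
- by apply: filterS (near_C2 mG Uu) => w; exact: df.
- by apply: filterS (near_C2 mG Uu) => w; exact: df2.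
- by apply: filterS (near_C2 mG Uu) => w; exact: df2.
- exact: cf2.
- exact: cf2.
Qed.

Lemma differentiable_grad u : U u -> differentiable (grad G f) u.
Proof.
move=> Uu; rewrite grad.unlock.
apply: differentiable_mulmx (differentiable_invgram mG Uu).
apply: differentiable_mx => i l; under eq_fun do rewrite mxE.
exact: differentiable_dlog.
Qed.

Definition nabla_grad u x : 'rV[R]_m :=
  'D_x (grad G f) u + Gamma G u x (grad G f u).

(** Differentiate the pairing of [grad] with the constant field [y] and use metric compatibility. *)
Lemma derive_dlog u x y : U u -> 'D_x ((dlog f)^~ y : _ -> R^o) u =
  dot G u (nabla_grad u x) y + dlog f u (Gamma G u x y).
Proof.
move=> Uu; have -> : 'D_x ((dlog f)^~ y : _ -> R^o) u =
    'D_x (fun w => inner G w (grad G f w) (cst y w) : R^o) u.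
  apply: near_eq_derive; apply: filterS (near_C2 mG Uu) => w Uw.
  by rewrite dotE dot_grad.
have [_ ->] := is_derive_inner (diff_derivable (C2_diff mG Uu) : derivable G u x)
  (diff_derivable (differentiable_grad Uu)) (derivable_cst y u x).
have z00 : (0 : 'M[R]_1) 0 0 = 0 by rewrite mxE.
rewrite derive_cst trmx0 mulmx0 z00 addr0.
rewrite -/(inner G u ('D_x (grad G f) u) y) dotE.
have -> : (grad G f u *m 'D_x G u *m (cst y u)^T) 0 0 =
    dinner G u x (grad G f u) y.
  by rewrite dinner.unlock.
by rewrite (dinner_compat mG) // -dot_grad // /nabla_grad dotDl addrA.
Qed.

Lemma derive_Gamma_conf u x y z : U u ->
  'D_x (fun w => Gamma G' w y z) u =
  'D_x (fun w => Gamma G w y z) u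
  + (dot G u (nabla_grad u x) y + dlog f u (Gamma G u x y)) *: z
  + (dot G u (nabla_grad u x) z + dlog f u (Gamma G u x z)) *: y
  - ((dot G u (Gamma G u x y) z + dot G u y (Gamma G u x z)) *: grad G f u
     + dot G u y z *: 'D_x (grad G f) u).
Proof.
move=> Uu.
have -> : 'D_x (fun w => Gamma G' w y z) u =
   'D_x ((fun w => Gamma G w y z) + (fun w => dlog f w y *: z)
     + (fun w => dlog f w z *: y) - (fun w => dot G w y z *: grad G f w)) u.
  apply: near_eq_derive; apply: filterS (near_C2 mG Uu) => w Uw.
  exact: Gamma_conf.
have dl (a b : 'rV[R]_m) : is_derive u x (fun w => dlog f w a *: b)
    ((dot G u (nabla_grad u x) a + dlog f u (Gamma G u x a)) *: b).
  have := is_derive_scalemx x (differentiable_dlog a Uu) (differentiable_cst b u).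
  by rewrite derive_cst scaler0 addr0 derive_dlog.
have dg := is_derive_scalemx x (differentiable_dot mG y z Uu)
  (differentiable_grad Uu).
have dG : is_derive u x (fun w => Gamma G w y z)
    ('D_x (fun w => Gamma G w y z) u).
  exact/derivableP/diff_derivable/(differentiable_Gamma mG).
have [_ ->] := is_deriveB (is_deriveD (is_deriveD dG (dl y z)) (dl z y)) dg.
by rewrite (derive_dot mG).
Qed.

(** Lowered by [G], this is minus the change of the Schouten tensor from [G] to [G']. *)
Definition hess u x : 'rV[R]_m :=
  nabla_grad u x - dlog f u x *: grad G f u
  + (2^-1 * dot G u (grad G f u) (grad G f u)) *: x.

(** Since [dlog] is closed and the Christoffel symbols are symmetric, [nabla_grad] is self-adjoint;
    the other two terms are plainly so. *)
Lemma hessC u x y : U u -> dot G u (hess u x) y = dot G u (hess u y) x.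
Proof.
move=> Uu; have := derive_dlogC x y Uu.
rewrite !derive_dlog // (GammaC mG y x) //.
move=> /addIr; rewrite /hess !dot_lin !dot_grad // => ->.
by rewrite [dot G u y x](dotC _ _ (C2_sym mG Uu)) // [dlog f u y * _]mulrC.
Qed.

Lemma curvature_conf u x y z : U u -> curvature G' u x y z =
  curvature G u x y z
  - (dot G u (hess u y) z *: x - dot G u (hess u x) z *: y
     + dot G u y z *: hess u x - dot G u x z *: hess u y).
Proof.
move=> Uu; rewrite (curvatureE mG') // (curvatureE mG) // !derive_Gamma_conf //.
(* The resulting [sN] is the self-adjointness of [nabla_grad]: it cancels the multiples of [z] that
   come from differentiating [dlog] of [x] and of [y]. *)
have := derive_dlogC x y Uu.
rewrite !derive_dlog // (GammaC mG y x) // => /addIr sN.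
(* Passing to covariant derivatives of the gradient lets the leftover Christoffel terms cancel. *)
have dA (a : 'rV[R]_m) : 'D_a (grad G f) u =
    nabla_grad u a - Gamma G u a (grad G f u).
  by rewrite /nabla_grad addrK.
have sG := C2_sym mG Uu.
rewrite !dA !Gamma_conf // -!scaleNr !(GammaD mG _ _ _ Uu) !(GammaZ mG _ _ _ Uu).
rewrite /hess -!dot_grad // (GammaC mG y x Uu) sN.
rewrite !dot_lin [dot G u y x]dotC //.
rewrite [dot G u x (grad G f u)]dotC // [dot G u y (grad G f u)]dotC //.
move: (grad G f u) (nabla_grad u x) (nabla_grad u y) => A nx ny.
move: ('D_x _ u) ('D_y _ u) (Gamma G u x y) (Gamma G u x A) (Gamma G u y A).
move: (Gamma G u x z) (Gamma G u y z) => xz yz dx dy xy xA yA.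
move: (Gamma G u _ _) (Gamma G u _ _) => xyz yxz.
move: (dot G u) => g.
apply/rowP => i; rewrite !mxE.
by field.
Qed.

End Conformal.

(** * Invariance of the Weyl operator, with frames [E] for [G] and [r *: E] for [G'] *)

Section WeylInvariance.
Variables (R : realType) (m : nat) (U : set 'rV[R]_m).
Variables (G G' : 'rV[R]_m -> 'M[R]_m) (f : 'rV[R]_m -> R^o).
Hypotheses (mG : C2_metric U G) (mG' : C2_metric U G').
Hypotheses (GE : forall u, U u -> G' u = f u *: G u)
  (f0 : forall u, U u -> f u != 0)
  (df : forall u, U u -> differentiable f u)
  (df2 : forall u v, U u -> differentiable ('D_v f) u)
  (cf2 : forall u v w, U u -> {for u, continuous ('D_w ('D_v f))}).
Variables (u : 'rV[R]_m) (E : 'M[R]_m) (r : R).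
Hypotheses (Uu : U u) (oE : orthonormal_frame G u E) (rf : r ^+ 2 * f u = 1).
Implicit Types x y z : 'rV[R]_m.

Let row_scale k : row k (r *: E) = r *: row k E.
Proof. by rewrite linearZ. Qed.

Let h x y := dot G u (hess G f u x) y.
Let trh := \sum_k h (row k E) (row k E).

(** Contract [curvature_conf] over the frame: one term gives the trace [trh], one gives [m] copies
    of [h x y], and two mixed terms each remove one copy. *)
Lemma ricci_conf x y : ricci G' u (r *: E) x y =
  ricci G u E x y - (trh * dot G u x y + (m%:R - 2) * h x y).
Proof.
have sum_dot (a b : 'rV[R]_m) :
    \sum_k dot G u a (row k E) * dot G u b (row k E) = dot G u a b.
  exact: (frame_dot mG Uu oE).
have hC (a b : 'rV[R]_m) : h a b = h b a by exact: (hessC mG f0 df df2 cf2).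
have sG := C2_sym mG Uu.
transitivity (\sum_k (dot G u (curvature G u x (row k E) (row k E)) y
    - (h (row k E) (row k E) * dot G u x y - h x (row k E) * dot G u y (row k E)
       + h x y - dot G u x (row k E) * h y (row k E)))).
  rewrite /ricci; apply: eq_bigr => k _; rewrite row_scale /curvature4.
  rewrite (curvatureZm mG') // (curvatureZr mG') // dotE (dot_conf GE) // !dotZl.
  (* The rescaled frame vector occurs twice and the new metric brings [f u]; these factors multiply
     to 1. *)
  rewrite !mulrA -[f u * r * r]mulrA -expr2 [f u * _]mulrC rf mul1r.
  rewrite (curvature_conf mG mG' GE f0 df df2 cf2) //.
  have ek : dot G u (row k E) (row k E) = 1 by rewrite -dotE oE eqxx.
  rewrite ek scale1r dotDl dotNl; congr (_ - _).
  rewrite [h y _]hC [dot G u y _]dotC // /h.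
  by rewrite !(dotDl, dotNl, dotZl).
rewrite sumrB; congr (_ - _); first by rewrite /ricci /curvature4 dotE.
rewrite sumrB big_split sumrB /= -mulr_suml -/trh sum_dot -/(h x y).
rewrite sumr_const card_ord (_ : \sum_i _ = h x y); last first.
  by under eq_bigr do rewrite /h mulrC; rewrite sum_dot hC.
rewrite -mulr_natl; ring.
Qed.

(** Raising the index with [r *: E] produces [r ^+ 2]. Expanding [x] and [hess G f u x] in [E]
    reduces the identity to [ricci_conf] summand by summand. *)
Lemma ricci_op_conf x : ricci_op G' u (r *: E) x =
  r ^+ 2 *: (ricci_op G u E x - trh *: x - (m%:R - 2) *: hess G f u x).
Proof.
have sum_row (v : 'rV[R]_m) : \sum_k dot G u v (row k E) *: row k E = v.
  exact: (frame_sum oE).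
rewrite /ricci_op -[in trh *: x](sum_row x) -[hess G f u x](sum_row) !scaler_sumr.
rewrite -!sumrB scaler_sumr; apply: eq_bigr => j _.
rewrite row_scale ricciZr scalerA mulrC mulrA -expr2 -scalerA ricci_conf.
by rewrite !scalerA -!scalerBl opprD addrA -scalerA.
Qed.

(** Tracing [ricci_conf] yields [m * trh] and [(m - 2) * trh], in total [2 * (m - 1) * trh]. *)
Lemma scalar_curvature_conf : scalar_curvature G' u (r *: E) =
  r ^+ 2 * (scalar_curvature G u E - 2 * (m%:R - 1) * trh).
Proof.
transitivity (\sum_k r ^+ 2 * (ricci G u E (row k E) (row k E) -
    (trh + (m%:R - 2) * h (row k E) (row k E)))).
  apply: eq_bigr => k _; rewrite row_scale ricciZr (ricciZl mG' _ Uu).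
  have ek : dot G u (row k E) (row k E) = 1 by rewrite -dotE oE eqxx.
  by rewrite mulrA -expr2 ricci_conf ek mulr1.
rewrite -mulr_sumr sumrB big_split /= -mulr_sumr -/trh sumr_const card_ord.
rewrite -[trh *+ m]mulr_natl -/(scalar_curvature G u E); ring.
Qed.

(** The factors [r ^+ 2] and [f u] cancel in the [R0] and [L] terms. The [hess] terms of the
    curvature cancel those of [L], and the [trh] terms of [L] cancel those of the scalar curvature.
    The bound on [m] makes both denominators nonzero. *)
Lemma weyl_conf x y z : (3 <= m)%N ->
  weyl G' u (r *: E) x y z = weyl G u E x y z.
Proof.
move=> m3; have m1 : (m%:R - 1 : R) != 0.
  by rewrite subr_eq0 (eqr_nat _ m 1) gtn_eqF // ltnW.
have m2 : (m%:R - 2 : R) != 0 by rewrite subr_eq0 (eqr_nat _ m 2) gtn_eqF.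
rewrite /weyl (curvature_conf mG mG' GE f0 df df2 cf2) // scalar_curvature_conf.
rewrite /R0 /L !ricci_op_conf !dotE !(dot_conf GE _ _ Uu).
move: rf m1 m2.
move: (curvature _ _ _ _ _) (scalar_curvature _ _ _) trh => C s t.
move: (ricci_op _ _ _ x) (ricci_op _ _ _ y) => p q.
move: (hess _ _ _ x) (hess _ _ _ y) => hx hy.
move: (f u) (m%:R) => a n ra n1 n2.
have -> : a = (r ^+ 2)^-1.
  have r0 : r ^+ 2 != 0.
    by apply: contra_eq_neq ra => ->; rewrite mul0r eq_sym oner_eq0.
  by rewrite -[LHS](mulKf r0) ra mulr1.
have r0 : r != 0.
  by apply: contra_eq_neq ra => ->; rewrite expr0n mul0r eq_sym oner_eq0.
rewrite !dot_lin; move: (dot G u) => g.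
apply/rowP => i; rewrite !mxE.
by field; rewrite n1 n2.
Qed.

Lemma conformal_jacobi_conf x : (3 <= m)%N ->
  conformal_jacobi G' u (r *: E) x = conformal_jacobi G u E x.
Proof.
move=> m3; apply/matrixP => i j.
by rewrite [LHS]mxE weyl_conf // [RHS]mxE.
Qed.

End WeylInvariance.

(** * Rescaled spectra, and passage from the manifold to charts *)

Lemma rank_eigenspaceZ (R : fieldType) m (A : 'M[R]_m) (c a : R) : c != 0 ->
  \rank (eigenspace (c *: A) (c * a)) = \rank (eigenspace A a).
Proof.
move=> c0; rewrite /eigenspace -scale_scalar_mx -scalerBr.
by rewrite !mxrank_ker mxrank_scale_nz.
Qed.

(** Multiplication by [c] is a bijection of the scalars that carries the eigenspaces of [A] and [B]
    to those of [A'] and [B'] with equal dimensions. *)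
Lemma same_eigenvaluesZ (R : realType) m (A B A' B' : 'M[R]_m) c : c != 0 ->
  A' = c *: A -> B' = c *: B -> same_eigenvalues A' B' <-> same_eigenvalues A B.
Proof.
move=> c0 -> ->; have Z (C : 'M[R]_m) b := rank_eigenspaceZ C b c0.
split=> AB a.
  exact: (etrans (esym (Z _ _)) (etrans (AB (c * a)) (Z _ _))).
rewrite -[a](mulVKf c0).
exact: (etrans (Z _ _) (etrans (AB (c^-1 * a)) (esym (Z _ _)))).
Qed.

(** A vector in the kernel of the Gram matrix has square length 0. *)
Lemma posdef_unitmx (R : realType) m (G : 'rV[R]_m -> 'M[R]_m) u :
  (forall x, x != 0 -> 0 < inner G u x x) -> G u \in unitmx.
Proof.
move=> pG; rewrite -row_free_unit -kermx_eq0; apply/rowV0P => v /sub_kermxP vG.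
apply/eqP/negPn/negP => /pG.
by rewrite /inner vG mul0mx mxE ltxx.
Qed.

Lemma gram_C2 (R : realType) m (M : smooth_manifold R m)
    (g : riemannian_metric M) (c : chart R m M) :
  atlas c -> C2_metric (cmap c @` cdom c) (gram g c).
Proof.
move=> ac; split.
- exact: cimg_open.
- by move=> _ [p cp <-]; exact: gram_sym.
- by move=> _ [p cp <-]; apply: posdef_unitmx; exact: gram_posdef.
- by have [] := gram_smooth g ac 1%N.
- by move=> u v; have [_ /(_ v)[+ _]] := gram_smooth g ac 2%N; exact.
Qed.


Theorem theorem1p2 (R : realType) (m : nat) (M : smooth_manifold R m)
    (g1 g2 : riemannian_metric M) (hm : (3 <= m)%N)
    (hg : conformally_equivalent g1 g2) :
  conformally_osserman g1 <-> conformally_osserman g2.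
Proof.
have [alpha [sa pa ga]] := hg.
(* Multiplication by [r p] carries [g2]-unit vectors at [p] to [g1]-unit vectors. *)
pose r p := Num.sqrt (alpha p)^-1.
have r0 p : r p != 0 by rewrite gt_eqF // sqrtr_gt0 invr_gt0.
have ra p : r p ^+ 2 * alpha p = 1.
  by rewrite sqr_sqrtr ?invr_ge0 ?ltW // mulVf // gt_eqF.
have inner12 c p a b : atlas c -> cdom c p ->
    inner (gram g1 c) (cmap c p) (r p *: a) (r p *: b) =
    inner (gram g2 c) (cmap c p) a b.
  move=> ac cp; rewrite /inner ga // -scalemxAr linearZ /=.
  rewrite -!scalemxAr -!scalemxAl.
  rewrite !scalerA (_ : _ * _ = 1) ?scale1r // -(ra p); ring.
have orth12 c p E : atlas c -> cdom c p ->
    orthonormal_frame (gram g1 c) (cmap c p) (r p *: E) <->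
    orthonormal_frame (gram g2 c) (cmap c p) E.
  by move=> ac cp; split=> oE i j; have := oE i j; rewrite !linearZ /= inner12.
have jacobi12 c p E x : atlas c -> cdom c p ->
    orthonormal_frame (gram g2 c) (cmap c p) E ->
    conformal_jacobi (gram g1 c) (cmap c p) (r p *: E) (r p *: x) =
    r p ^+ 2 *: conformal_jacobi (gram g2 c) (cmap c p) E x.
  move=> ac cp oE; have Up : (cmap c @` cdom c) (cmap c p) by exists p.
  have cK q : cdom c q -> (alpha \o cinv c) (cmap c q) = alpha q.
    by move=> cq; rewrite /= cmapK.
  (* The factor [r p ^+ 2] is absorbed into the vector, so that both sides are evaluated at
     [r p *: x] and conformal invariance applies. *)
  rewrite -(conformal_jacobiZ (gram_C2 g2 ac)) //.
  apply: (@conformal_jacobi_conf _ _ _ _ _ (alpha \o cinv c : _ -> R^o)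
    (gram_C2 g2 ac) (gram_C2 g1 ac)) => //.
  - by move=> _ [q cq <-]; rewrite cK // ga.
  - by move=> _ [q cq <-]; rewrite cK // gt_eqF.
  - by have [] := sa _ ac 1%N.
  - by move=> u v; have [_ /(_ v)[+ _]] := sa _ ac 2%N; exact.
  (* Class C^2 includes continuity of the second derivatives, as the symmetry argument requires. *)
  - by move=> u v w; have [_ /(_ v)[_ /(_ w)]] := sa _ ac 2%N; exact.
  - by rewrite cK.
have same12 c p E x y : atlas c -> cdom c p ->
    orthonormal_frame (gram g2 c) (cmap c p) E ->
    same_eigenvalues
      (conformal_jacobi (gram g1 c) (cmap c p) (r p *: E) (r p *: x))
      (conformal_jacobi (gram g1 c) (cmap c p) (r p *: E) (r p *: y)) <->
    same_eigenvalues (conformal_jacobi (gram g2 c) (cmap c p) E x)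
                     (conformal_jacobi (gram g2 c) (cmap c p) E y).
  move=> ac cp oE; have r20 : r p ^+ 2 != 0 by rewrite expf_neq0.
  exact: (same_eigenvaluesZ r20 (jacobi12 c p E x ac cp oE)
    (jacobi12 c p E y ac cp oE)).
(* Any [g1]-orthonormal frame ([k = m]) or [g1]-unit vector ([k = 1]) is thus [r p] times some [W],
   which is then orthonormal or unit for [g2]; this serves the converse direction. *)
have unscale p k (V : 'M[R]_(k, m)) : exists W, V = r p *: W.
  by exists ((r p)^-1 *: V); rewrite scalerA divff // scale1r.
split=> os p c ac cp E oE x y x1 y1.
  apply: (same12 c p E x y ac cp oE).1; apply: os => //.
  - exact: (orth12 c p E ac cp).2.
  - by rewrite inner12.
  - by rewrite inner12.
move: oE x1 y1; have [E' ->] := unscale p _ E.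
have [x' ->] := unscale p _ x; have [y' ->] := unscale p _ y.
move=> /(orth12 _ _ _ ac cp) oE x1 y1.
apply: (same12 c p E' x' y' ac cp oE).2; apply: os => //.
- exact: etrans (esym (inner12 _ _ _ _ ac cp)) x1.
- exact: etrans (esym (inner12 _ _ _ _ ac cp)) y1.
Qed.
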